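(* Let $\mathcal{I}\subset\mathbb{R}$ be an open interval and let $\Phi:\mathcal{I}\to\mathbb{R}$ be smooth and convex and such that $A^\Phi$ is convex on $\mathcal{T}_{\mathcal{I}}$. Let $p\in[0,1]$, $q:=1-p$, $\rho\in[0,\infty)$, and for $n\in\mathbb{N}$ let $M_n:=\mathcal{B}(n,p)*\mathcal{P}(\rho)$. Then, for any $n\in\mathbb{N}$ and any $f\in\mathrm{L}^{1,\Phi}(M_n)$, $$\mathbf{Ent}_{M_n}^{\Phi}(f)\leq\rho\,\mathbf{E}_{M_n}\big(A^\Phi(f,\mathrm{D}f)\big)+npq\,\mathbf{E}_{M_{n-1}}\big(qA^\Phi(f,\mathrm{D}f)+pA^\Phi(\tau(f,\mathrm{D}f))\big).$$
   Context: $\mathbb{N}=\{0,1,2,\ldots\}$. $\mathcal{B}(n,p)$ is the binomial law $(p\delta_1+(1-p)\delta_0)^{*n}$ on $\mathbb{N}$ (with $\mathcal{B}(0,p)=\delta_0$), $\mathcal{P}(\rho)$ is the Poisson law of mean $\rho$ on $\mathbb{N}$ (with $\mathcal{P}(0)=\delta_0$), and $*$ is convolution. $\mathbf{E}_Q(f)$ is the mean of $f$ under $Q$. $\mathrm{L}^{1,\Phi}(Q)$ is the set of functions $f\in\mathrm{L}^1(Q)$ with values in $\mathcal{I}$ (here $f:\mathbb{N}\to\mathcal{I}$) such that $\Phi(f)\in\mathrm{L}^1(Q)$; for such $f$, $\mathbf{Ent}_Q^\Phi(f):=\mathbf{E}_Q(\Phi(f))-\Phi(\mathbf{E}_Qf)$.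 $\mathcal{T}_{\mathcal{I}}:=\{(u,v)\in\mathbb{R}^2: u\in\mathcal{I},\,u+v\in\mathcal{I}\}$; $A^\Phi:\mathcal{T}_{\mathcal{I}}\to\mathbb{R}$, $A^\Phi(u,v):=\Phi(u+v)-\Phi(u)-\Phi'(u)v$ (non-negative since $\Phi$ is convex); $\tau(u,v):=(u+v,-v)$. $\mathrm{D}f(k):=f(k+1)-f(k)$; $A^\Phi(f,\mathrm{D}f)$ is the function $k\mapsto A^\Phi(f(k),\mathrm{D}f(k))$, and similarly for $A^\Phi(\tau(f,\mathrm{D}f))$. The right-hand side takes values in $[0,+\infty]$ (with $0\cdot\infty=0$), and the second term is $0$ when $n=0$. *)

(* Defs.v *)
From HB Require Import structures.
From mathcomp Require Import all_boot all_order all_algebra.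
From mathcomp Require Import all_classical all_reals all_analysis.
Set Implicit Arguments.
Unset Strict Implicit.
Unset Printing Implicit Defensive.
Import Order.TTheory GRing.Theory Num.Theory.
Import numFieldNormedType.Exports.
Local Open Scope classical_set_scope.
Local Open Scope ring_scope.

Definition addn_pair (x : nat * nat) : nat := (x.1 + x.2)%N.

Lemma measurable_addn_pair : measurable_fun [set: nat * nat] addn_pair.
Proof.
move=> _ B _; rewrite setTI.
have -> : addn_pair @^-1` B =
    \bigcup_i \bigcup_(j in [set j | B (i + j)%N]) ([set i] `*` [set j]).
  apply/seteqP; split=> [[i j] Bij|[i j] [i' _] [j' Bij [/= -> ->]]] //.
  by exists i => //; exists j.
by do 2![apply: bigcup_measurable => ? _]; exact: measurableX.
Qed.

HB.instance Definition _ :=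
  isMeasurableFun.Build _ _ _ _ addn_pair measurable_addn_pair.

Section defs.
Context {R : realType}.

Definition convolution (P Q : probability nat R) : probability nat R :=
  distribution (P \x Q)%E addn_pair.

(* The second argument of [poisson_prob] is a dummy.  Both library laws are
   the Dirac measure at 0 in the degenerate cases n = 0 and rho = 0. *)
Definition binomial_poisson (p rho : R) (n : nat) : probability nat R :=
  convolution (binomial_prob n p) (poisson_prob rho 0).

(* For an open set I, the iterated derivatives at the points of I depend only
   on the restriction of Phi to I. *)
Definition smooth_on (I : set R) (Phi : R -> R) : Prop :=
  forall n x, I x -> derivable (derive1n n Phi) x 1.

Definition T_ (I : set R) : set (R^o * R^o) :=
  [set w | I w.1 /\ I (w.1 + w.2)].

Definition A_ (Phi : R -> R) (w : R^o * R^o) : R :=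
  Phi (w.1 + w.2) - Phi w.1 - derive1 Phi w.1 * w.2.

Definition tau (w : R^o * R^o) : R^o * R^o := (w.1 + w.2, - w.2).

Definition Delta (f : nat -> R) (k : nat) : R := f k.+1 - f k.

Definition L1Phi (I : set R) (Phi : R -> R) (Q : probability nat R)
    (f : nat -> R) : Prop :=
  [/\ forall k, I (f k),
      Q.-integrable [set: nat] (EFin \o f) &
      Q.-integrable [set: nat] (EFin \o (Phi \o f))].

Definition Ent (Phi : R -> R) (Q : probability nat R) (f : nat -> R) : \bar R :=
  ('E_Q[Phi \o f] - (Phi (fine 'E_Q[f]))%:E)%E.

End defs.

(* Main.v *)
(** A function of a sum of n Bernoulli(p) and N Bernoulli(h) variables loses
    its Phi-entropy one variable at a time.  Each Bernoulli step costs at most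
    p q (q A(f,Df) + p A(tau(f,Df))): in p, this bound is the cubic Hermite
    interpolant of the two-point entropy at 0 and 1, and it lies above the
    entropy because convexity of A forces Phi'' to be convex.  Joint convexity of A carries the costs of later steps
    back to f by Jensen's inequality.  With h = rho / N and N going to infinity
    the N variables become Poisson, and the tau term weighted by h disappears;
    this limit is taken for eventually constant f, where it only involves
    finitely many weights.  For general f one truncates to f (min k m); the
    energies can only decrease, and the entropies converge by dominated
    convergence along well-chosen levels m. *)
Require Import Defs.
From HB Require Import structures.
From mathcomp Require Import all_boot all_order all_algebra.
From mathcomp Require Import all_classical all_reals all_analysis.
From mathcomp Require Import ring lra.
Set Implicit Arguments.
Unset Strict Implicit.
Unset Printing Implicit Defensive.
Import Order.TTheory GRing.Theory Num.Theory.
Import numFieldNormedType.Exports.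
Local Open Scope classical_set_scope.
Local Open Scope ring_scope.

(** * Rolle's theorem and a Hermite bound for functions with convex second derivative *)

Lemma derivative_root_between (R : realType) (g g1 : R -> R) (a b : R) :
  a < b -> (forall x : R, a <= x <= b -> is_derive x 1 g (g1 x)) -> g a = g b ->
  exists2 c, a < c < b & g1 c = 0.
Proof.
move=> ab dg gab.
have [||c cab gc0] := Rolle ab _ _ gab.
- move=> x; rewrite in_itv/= => /andP[/ltW ax /ltW xb].
  by have := dg x; rewrite ax xb => /(_ isT) [].
- apply: derivable_within_continuous => x; rewrite in_itv/= => /dg[] //.
exists c; first by move: cab; rewrite in_itv.
move: cab; rewrite in_itv/= => /andP[/ltW ac /ltW cb].
have := dg c; rewrite ac cb => /(_ isT) dgc.
by rewrite -(@derive_val _ _ _ _ _ _ _ dgc) (@derive_val _ _ _ _ _ _ _ gc0).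
Qed.

(* As a function of p, the right-hand side is the cubic polynomial with the
   same values and the same derivatives as the left-hand side at 0 and at 1. *)
Lemma chord_gap_le (R : realType) (g g1 g2 : R -> R) (p : R) :
  (forall x : R, 0 <= x <= 1 -> is_derive x 1 g (g1 x)) ->
  (forall x : R, 0 <= x <= 1 -> is_derive x 1 g1 (g2 x)) ->
  (forall t x y : R, 0 <= t <= 1 -> 0 <= x <= 1 -> 0 <= y <= 1 ->
     g2 (t * x + (1 - t) * y) <= t * g2 x + (1 - t) * g2 y) ->
  0 <= p <= 1 ->
  (1 - p) * g 0 + p * g 1 - g p <=
  p * (1 - p) * ((1 - p) * (g 1 - g 0 - g1 0) + p * (g 0 - g 1 + g1 1)).
Proof.
move=> dg dg1 cvx /andP[p0 p1].
set al := g 1 - g 0 - g1 0; set be := g 0 - g 1 + g1 1.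
rewrite leNgt; apply/negP => lt_p.
have {}p0 : 0 < p.
  rewrite lt_neqAle p0 andbT; apply/eqP => p_eq; move: lt_p.
  by rewrite -p_eq; lra.
have {}p1 : p < 1.
  rewrite lt_neqAle p1 andbT; apply/eqP => p_eq; move: lt_p.
  by rewrite p_eq; lra.
(* [c] is chosen so that [Z], the defect of the bound minus c x^2 (1 - x)^2, vanishes at p; the
   correction keeps the double zeros at 0 and 1. Failure of the bound at p means c < 0. *)
pose c := (p * (1 - p) * ((1 - p) * al + p * be) -
  ((1 - p) * g 0 + p * g 1 - g p)) / (p ^+ 2 * (1 - p) ^+ 2).
have c0 : c < 0.
  rewrite /c pmulr_llt0 ?subr_lt0// invr_gt0 mulr_gt0// exprn_gt0// subr_gt0//.
pose Z (x : R) := x * (1 - x) * ((1 - x) * al + x * be) -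
  ((1 - x) * g 0 + x * g 1 - g x) - c * (x ^+ 2 * (1 - x) ^+ 2).
pose Z1 (x : R) : R := (1 - 4 * x + 3 * x ^+ 2) * al + (2 * x - 3 * x ^+ 2) * be -
  (g 1 - g 0 - g1 x) - c * (2 * x - 6 * x ^+ 2 + 4 * x ^+ 3).
pose Z2 (x : R) := (6 * x - 4) * al + (2 - 6 * x) * be + g2 x
  - c * (2 - 12 * x + 12 * x ^+ 2).
have dZ (x : R) : 0 <= x <= 1 -> is_derive x 1 Z (Z1 x).
  move=> /dg dgx; rewrite /Z /Z1.
  apply: is_derive_eq; rewrite /GRing.scale/=; ring.
have dZ1 (x : R) : 0 <= x <= 1 -> is_derive x 1 Z1 (Z2 x).
  move=> /dg1 dgx; rewrite /Z1 /Z2.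
  apply: is_derive_eq; rewrite /GRing.scale/=; ring.
have Z0 : Z 0 = 0 by rewrite /Z; ring.
have Z1' : Z 1 = 0 by rewrite /Z; ring.
have Zp : Z p = 0.
  rewrite /Z /c; field; rewrite !lt0r_neq0 ?subr_gt0//.
(* Zero count: [Z] vanishes at 0, p and 1, so [Z1] has a zero in each gap; with its zeros at 0 and 1
   it has four, hence [Z2] has three. *)
have [//|x /andP[? ?]||e1 /andP[e10 e1p] Ze1] := @derivative_root_between _ Z Z1 0 p.
- by apply: dZ; lra.
- by rewrite Z0.
have [//|x /andP[? ?]||e2 /andP[e2p e21] Ze2] := @derivative_root_between _ Z Z1 p 1.
- by apply: dZ; lra.
- by rewrite Zp.
have Z10 : Z1 0 = 0 by rewrite /Z1 /al; ring.
have Z11 : Z1 1 = 0 by rewrite /Z1 /be; ring.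
have [//|x /andP[? ?]||x1 /andP[x1l x1u] Zx1] :=
    @derivative_root_between _ Z1 Z2 0 e1.
- by apply: dZ1; lra.
- by rewrite Z10.
have [|x /andP[? ?]||x2 /andP[x2l x2u] Zx2] :=
    @derivative_root_between _ Z1 Z2 e1 e2.
- exact: lt_trans e2p.
- by apply: dZ1; lra.
- by rewrite Ze1.
have [//|x /andP[? ?]||x3 /andP[x3l x3u] Zx3] :=
    @derivative_root_between _ Z1 Z2 e2 1.
- by apply: dZ1; lra.
- by rewrite Ze2.
(* At the zeros of [Z2], [g2] agrees with 12 c x^2 plus an affine function, which is strictly
   concave as c < 0; this contradicts convexity of [g2] at the middle zero. *)
pose t := (x3 - x2) / (x3 - x1).
have x13 : 0 < x3 - x1 by lra.
have t0 : 0 < t by rewrite divr_gt0//; lra.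
have t1 : t < 1 by rewrite ltr_pdivrMr//; lra.
have x2E : x2 = t * x1 + (1 - t) * x3.
  by rewrite /t; field; rewrite lt0r_neq0.
have := cvx t x1 x3; rewrite -x2E.
have := Zx1; have := Zx2; have := Zx3; rewrite /Z2.
move=> /eqP h3 /eqP h2 /eqP h1.
move: h1 h2 h3; rewrite !subr_eq !add0r => /eqP h1 /eqP h2 /eqP h3 cv.
have {cv} : g2 x2 <= t * g2 x1 + (1 - t) * g2 x3 by apply: cv; lra.
have -> : g2 x1 = c * (2 - 12 * x1 + 12 * x1 ^+ 2) -
    ((6 * x1 - 4) * al + (2 - 6 * x1) * be).
  by rewrite -h1; ring.
have -> : g2 x3 = c * (2 - 12 * x3 + 12 * x3 ^+ 2) -
    ((6 * x3 - 4) * al + (2 - 6 * x3) * be).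
  by rewrite -h3; ring.
have -> : g2 x2 = c * (2 - 12 * x2 + 12 * x2 ^+ 2) -
    ((6 * x2 - 4) * al + (2 - 6 * x2) * be).
  by rewrite -h2; ring.
rewrite x2E -subr_ge0.
rewrite (_ : _ - _ = 12 * (c * (t * (1 - t) * (x3 - x1) ^+ 2))); last by ring.
apply/negP; rewrite -ltNge pmulr_rlt0// nmulr_rlt0//.
apply: mulr_gt0; last by rewrite exprn_gt0.
by apply: mulr_gt0; lra.
Qed.

(** * Convexity and sign of [A_], convexity of the second derivative, the two-point inequality *)

Lemma is_interval_conv (R : realType) (I : set R) (t x y : R) :
  is_interval I -> 0 <= t <= 1 -> I x -> I y -> I (t * x + (1 - t) * y).
Proof.
move=> I_itv /andP[t0 t1]; wlog xy : t x y t0 t1 / x <= y => [hw|] Ix Iy.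
  have [xy|yx] := leP x y; first exact: hw.
  rewrite addrC -[t in t * x](subKr 1); apply: hw => //; lra.
apply: (I_itv x y) => //; apply/andP; split; nra.
Qed.

Lemma smooth_on_is_derive (R : realType) (I : set R) (Phi : R -> R) n x :
  smooth_on I Phi -> I x -> is_derive x 1 (derive1n n Phi) (derive1n n.+1 Phi x).
Proof.
by move=> sm Ix; rewrite derive1nS derive1E; apply: derivableP; exact: sm.
Qed.

(** Taylor expansion for small positive increments; it recovers Phi'' from [A_], so that convexity
    can be handed on from [A_] to Phi''. *)
Lemma A_second_order (R : realType) (I : set R) (Phi : R -> R) (w e : R) :
  open I -> smooth_on I Phi -> I w -> 0 < e ->
  exists2 d, 0 < d & forall v, 0 < v < d -> I (w + v) /\
    `| A_ Phi (w, v) - derive1n 2 Phi w * v ^+ 2 / 2 | <= e * v ^+ 2.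
Proof.
move=> I_open sm Iw e0.
have cont : {for w, continuous (derive1n 2 Phi)}.
  by apply: differentiable_continuous; apply/derivable1_diffP; exact: sm.
have /nbhs_ballP[d /= d0 wd] : nbhs w
    (I `&` [set x | `|derive1n 2 Phi w - derive1n 2 Phi x| < e]).
  apply: filterI; first exact: open_nbhs_nbhs.
  by move/cvgrPdist_lt : cont => /(_ _ e0).
have {}wd x : w <= x < w + d ->
    I x /\ `|derive1n 2 Phi w - derive1n 2 Phi x| < e.
  move=> /andP[wx xd]; apply: wd; rewrite /ball/= distrC ger0_norm ?subr_ge0//.
  by rewrite ltrBlDl.
exists d => // v /andP[v0 vd]; split.
  by apply: (wd _ _).1; rewrite lerDl (ltW v0) ltrD2l.
(* [K] makes the remainder [g] vanish at w + v as well as at w. Rolle gives a zero of [g1], which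
   also vanishes at w, then a zero x of [g2]; so [A_ Phi (w, v)] is exactly Phi''(x) v^2 / 2. *)
pose K := A_ Phi (w, v) / v ^+ 2.
pose g x := Phi x - Phi w - derive1 Phi w * (x - w) - K * (x - w) ^+ 2.
pose g1 x : R := derive1 Phi x - derive1 Phi w - 2 * K * (x - w).
pose g2 x : R := derive1n 2 Phi x - 2 * K.
have dg (x : R) : w <= x <= w + v -> is_derive x 1 g (g1 x).
  move=> /andP[wx xv]; have Ix : I x.
    by apply: (wd _ _).1; rewrite wx (le_lt_trans xv)// ltrD2l.
  have := @smooth_on_is_derive _ _ _ 0 _ sm Ix.
  rewrite derive1n0 derive1n1 => dx; rewrite /g /g1.
  apply: is_derive_eq; rewrite /GRing.scale/=; ring.
have dg1 (x : R) : w <= x <= w + v -> is_derive x 1 g1 (g2 x).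
  move=> /andP[wx xv]; have Ix : I x.
    by apply: (wd _ _).1; rewrite wx (le_lt_trans xv)// ltrD2l.
  have := @smooth_on_is_derive _ _ _ 1 _ sm Ix.
  rewrite derive1n1 => dx; rewrite /g1 /g2.
  apply: is_derive_eq; rewrite /GRing.scale/=; ring.
have vn0 : v != 0 by rewrite lt0r_neq0.
have wv : w < w + v by rewrite ltrDl.
have gE : g w = g (w + v) by rewrite /g /K /A_/=; field.
have [c /andP[wc cv] gc] := derivative_root_between wv dg gE.
have [//|x /andP[wx xc]||x /andP[wx xc] gx] :=
    @derivative_root_between _ g1 g2 w c.
- by apply: dg1; rewrite wx (le_trans xc)// ltW.
- by rewrite gc /g1; ring.
have [|_ dx] := wd x; first by rewrite (ltW wx); lra.
have -> : A_ Phi (w, v) = derive1n 2 Phi x * v ^+ 2 / 2.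
  have -> : derive1n 2 Phi x = 2 * K.
    by move/eqP : gx; rewrite subr_eq0 => /eqP.
  by rewrite /K; field.
rewrite -mulrBl -mulrBl normrM normrM distrC (ger0_norm (sqr_ge0 v)).
have e2 : `|2^-1 : R| <= 1 by rewrite ger0_norm//; lra.
rewrite -mulrA [leRHS](_ : _ = e * (v ^+ 2 * 1)); last by rewrite mulr1.
apply: ler_pM => //; [by rewrite mulr_ge0 ?sqr_ge0|exact: ltW|].
by apply: ler_wpM2l; rewrite ?sqr_ge0.
Qed.

Lemma convex_functionE (R : realType) (E : lmodType R) (D : set E) (f : E -> R)
    (t : R) (x y : E) :
  convex_function (D : set (convex_lmodType E)) f -> 0 <= t <= 1 -> D x -> D y ->
  f (t *: x + (1 - t) *: y) <= t * f x + (1 - t) * f y.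
Proof.
move=> cvx /andP[t0 t1] Dx Dy.
have t01 : Itv.spec (Itv.num_sem (R := R)) (Itv.Real `[0%Z, 1%Z]) t.
  by apply/and3P; split; rewrite ?in_itv/= ?num_real ?t0.
by have := cvx (Itv.mk t01) x y; rewrite !inE => /(_ Dx Dy).
Qed.

Lemma A_convexE (R : realType) (I : set R) (Phi : R -> R) (t u v u' v' : R) :
  convex_function (T_ I : set (convex_lmodType (R^o * R^o)%type)) (A_ Phi) ->
  0 <= t <= 1 -> I u -> I (u + v) -> I u' -> I (u' + v') ->
  A_ Phi (t * u + (1 - t) * u', t * v + (1 - t) * v') <=
  t * A_ Phi (u, v) + (1 - t) * A_ Phi (u', v').
Proof.
move=> cvx t01 Iu Iuv Iu' Iuv'.
exact: (convex_functionE (x := (u, v)) (y := (u', v')) cvx).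
Qed.

(** With a common increment v, the convex combination of (x, v) and (y, v) is (z, v); dividing the
    convexity inequality of [A_] by v^2 for small v leaves the one for Phi''. *)
Lemma derive2_convex (R : realType) (I : set R) (Phi : R -> R) (t x y : R) :
  open I -> is_interval I -> smooth_on I Phi ->
  convex_function (T_ I : set (convex_lmodType (R^o * R^o)%type)) (A_ Phi) ->
  0 <= t <= 1 -> I x -> I y ->
  derive1n 2 Phi (t * x + (1 - t) * y) <=
  t * derive1n 2 Phi x + (1 - t) * derive1n 2 Phi y.
Proof.
move=> I_open I_itv sm cvx t01 Ix Iy; apply/ler_addgt0Pr => e e0.
have Iz := is_interval_conv I_itv t01 Ix Iy.
(* The error e / 4 enters once on each side of the convexity inequality, and clearing the factor 1/2
   of the expansion turns the total into e. *)
have e40 : 0 < e / 4 by rewrite divr_gt0.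
have [dx dx0 Hx] := A_second_order I_open sm Ix e40.
have [dy dy0 Hy] := A_second_order I_open sm Iy e40.
have [dz dz0 Hz] := A_second_order I_open sm Iz e40.
set z := t * x + (1 - t) * y in Iz Hz *.
pose d := Num.min dx (Num.min dy dz).
have d0 : 0 < d by rewrite !lt_min dx0 dy0.
pose v := d / 2.
have v0 : 0 < v by rewrite divr_gt0.
have : v < d by rewrite /v; lra.
rewrite !lt_min => /and3P[vx vy vz].
have [|Ixv /ler_normlP[Axl Axu]] := Hx v; first by rewrite v0.
have [|Iyv /ler_normlP[Ayl Ayu]] := Hy v; first by rewrite v0.
have [|_ /ler_normlP[Azl Azu]] := Hz v; first by rewrite v0.
have := A_convexE cvx t01 Ix Ixv Iy Iyv.
rewrite -/z -mulrDl addrC subrK mul1r => conv.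
have v20 : 0 < v ^+ 2 by rewrite exprn_gt0.
case/andP: t01 => t0 t1.
have hx := ler_wpM2l t0 Axu.
have t1' : 0 <= 1 - t by rewrite subr_ge0.
have hy := ler_wpM2l t1' Ayu.
rewrite -(ler_pM2r v20); move: hy.
move: Azl hx conv; move: (v ^+ 2) (derive1n 2 Phi x) (derive1n 2 Phi y).
move: (derive1n 2 Phi z) (A_ Phi (x, v)) (A_ Phi (y, v)) (A_ Phi (z, v)).
move=> Z Ax Ay Az w X Y; clear; lra.
Qed.

(** Convexity bounds the quotient (Phi (u + h v) - Phi u) / h by Phi (u + v) - Phi u for 0 < h <= 1,
    and its limit from the right at 0 is Phi'(u) v. *)
Lemma A_ge0 (R : realType) (I : set R) (Phi : R -> R) (u v : R) :
  is_interval I -> smooth_on I Phi ->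
  convex_function (I : set (convex_lmodType R^o)) Phi ->
  I u -> I (u + v) -> 0 <= A_ Phi (u, v).
Proof.
move=> I_itv sm cvx Iu Iuv.
have dPhi := @smooth_on_is_derive _ _ _ 0 _ sm Iu.
rewrite derive1n0 derive1n1 in dPhi.
have : is_derive (0 : R) 1 (fun t => Phi (u + t * v)) (derive1 Phi u * v).
  have du : is_derive (0 : R) 1 (fun t => u + t * v) v.
    by apply: is_derive_eq; rewrite /GRing.scale/=; ring.
  by apply: is_derive1_comp; rewrite /= mul0r addr0.
move=> [dg gE]; rewrite /A_ /= subr_ge0.
have gc : (h^-1 * (Phi (u + h * v) - Phi u)) @[h --> (0 : R)^'] -->
    derive1 Phi u * v.
  move/cvg_ex : dg gE => [l gl] gE.
  have <- : l = derive1 Phi u * v by rewrite -gE; apply/esym/cvg_lim.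
  move: gl; rewrite /= mul0r addr0; apply: cvg_trans; apply: near_eq_cvg.
  near=> h; by rewrite /GRing.scale/= addr0 mulr1.
have /cvgr_to_le : (h^-1 * (Phi (u + h * v) - Phi u)) @[h --> (0 : R)^'+] -->
    derive1 Phi u * v.
  exact: cvg_dnbhs_at_right.
apply; near=> h.
have h0 : 0 < h by [].
have h1 : h <= 1 by near: h; apply: nbhs_right_le.
rewrite mulrC ler_pdivrMr//.
have h01 : 0 <= h <= 1 by rewrite ltW.
have := convex_functionE cvx h01 Iuv Iu; rewrite /GRing.scale/=.
rewrite (_ : h * (u + v) + (1 - h) * u = u + h * v); last by ring.
lra.
Unshelve. all: by end_near.
Qed.

(** The chord bound applied to x -> Phi (a + x (b - a)): its second derivative inherits convexity
    from Phi'', and its tangent defects at 0 and 1 are the two values of [A_]. *)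
Lemma bernoulli_entropy_le (R : realType) (I : set R) (Phi : R -> R) (p a b : R) :
  open I -> is_interval I -> smooth_on I Phi ->
  convex_function (T_ I : set (convex_lmodType (R^o * R^o)%type)) (A_ Phi) ->
  0 <= p <= 1 -> I a -> I b ->
  (1 - p) * Phi a + p * Phi b - Phi ((1 - p) * a + p * b) <=
  p * (1 - p) * ((1 - p) * A_ Phi (a, b - a) + p * A_ Phi (tau (a, b - a))).
Proof.
move=> I_open I_itv sm cvx p01 Ia Ib.
pose d := b - a.
have Id (x : R) : 0 <= x <= 1 -> I (a + x * d).
  move=> x01; rewrite (_ : a + x * d = x * b + (1 - x) * a); last by rewrite /d; ring.
  exact: is_interval_conv.
have dd n (x : R) : 0 <= x <= 1 -> is_derive x 1 (fun x => derive1n n Phi (a + x * d))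
     (derive1n n.+1 Phi (a + x * d) * d).
  move=> /Id Ix; have dPhi := smooth_on_is_derive n sm Ix.
  have du : is_derive (x : R) 1 (fun x => a + x * d) d.
    by apply: is_derive_eq; rewrite /GRing.scale/=; ring.
  exact: (@is_derive1_comp _ (derive1n n Phi) (fun x => a + x * d) _ _ _ dPhi du).
pose g (x : R) := Phi (a + x * d).
pose g1 (x : R) := derive1 Phi (a + x * d) * d.
pose g2 (x : R) := derive1n 2 Phi (a + x * d) * d * d.
have dg (x : R) : 0 <= x <= 1 -> is_derive x 1 g (g1 x).
  by move=> /(dd 0); rewrite derive1n1.
have dg1 (x : R) : 0 <= x <= 1 -> is_derive x 1 g1 (g2 x).
  move=> /(dd 1); rewrite derive1n1 /g1 /g2 => dx.
  by apply: is_derive_eq; rewrite /GRing.scale/=; ring.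
have c2 (t x y : R) : 0 <= t <= 1 -> 0 <= x <= 1 -> 0 <= y <= 1 ->
    g2 (t * x + (1 - t) * y) <= t * g2 x + (1 - t) * g2 y.
  move=> t01 /Id Ix /Id Iy; have := derive2_convex I_open I_itv sm cvx t01 Ix Iy.
  rewrite (_ : t * (a + x * d) + (1 - t) * (a + y * d) =
    a + (t * x + (1 - t) * y) * d); last by ring.
  rewrite /g2 => /(ler_wpM2l (sqr_ge0 d)).
  move: (derive1n _ _ _) (derive1n _ _ _) (derive1n _ _ _) => X Y Z; lra.
have := chord_gap_le dg dg1 c2 p01.
rewrite /g /g1 !mul0r !mul1r !addr0 /tau /A_ /= -/d.
have -> : a + d = b by rewrite /d; ring.
have -> : (1 - p) * a + p * b = a + p * d by rewrite /d; ring.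
have -> : b - d = a by rewrite /d; ring.
by rewrite mulrN opprK.
Qed.

(** * Averaging over Bernoulli steps *)

(* [bstep p F k] is the mean of F (k + B) for a Bernoulli variable B of
   parameter p; its n-th iterate averages over a binomial variable. *)
Definition bstep (R : realType) (p : R) (F : nat -> R) (k : nat) : R :=
  (1 - p) * F k + p * F k.+1.

(** Cost of one Bernoulli step, up to the factor p (1 - p). The parameter is free because the steps
    approximating the Poisson variable use it with another value. *)
Definition energy (R : realType) (Phi : R -> R) (p : R) (f : nat -> R) (k : nat) : R :=
  (1 - p) * A_ Phi (f k, Delta f k) + p * A_ Phi (tau (f k, Delta f k)).

Section bstep_lemmas.
Context {R : realType}.
Implicit Types (p h : R) (F G : nat -> R).

Lemma bstep_le p F G k : 0 <= p <= 1 -> (forall k, F k <= G k) ->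
  bstep p F k <= bstep p G k.
Proof.
move=> /andP[p0 p1] FG; rewrite /bstep lerD// ler_wpM2l// subr_ge0//.
Qed.

Lemma iter_bstep_le n p F G k : 0 <= p <= 1 -> (forall k, F k <= G k) ->
  iter n (bstep p) F k <= iter n (bstep p) G k.
Proof.
by move=> p01 FG; elim: n k => // n IH k; rewrite !iterS; exact: bstep_le.
Qed.

Lemma bstep_lin p a b F G k :
  bstep p (fun k => a * F k + b * G k) k = a * bstep p F k + b * bstep p G k.
Proof. by rewrite /bstep; ring. Qed.

Lemma iter_bstep_lin n p a b F G k :
  iter n (bstep p) (fun k => a * F k + b * G k) k =
  a * iter n (bstep p) F k + b * iter n (bstep p) G k.
Proof.
elim: n k => // n IH k; rewrite !iterS -bstep_lin.
by congr bstep; apply/funext.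
Qed.

Lemma iter_bstep_ge0 n p F k : 0 <= p <= 1 -> (forall k, 0 <= F k) ->
  0 <= iter n (bstep p) F k.
Proof.
by move=> /andP[p0 p1] F0; elim: n k => // n IH k;
  rewrite iterS /bstep addr_ge0// mulr_ge0// subr_ge0.
Qed.

Lemma iter_bstep_interval (I : set R) n p F k : is_interval I -> 0 <= p <= 1 ->
  (forall k, I (F k)) -> I (iter n (bstep p) F k).
Proof.
move=> I_itv p01 IF; elim: n k => // n IH k; rewrite iterS /bstep addrC.
exact: is_interval_conv.
Qed.

Lemma Delta_bstep p F k : Delta (bstep p F) k = bstep p (Delta F) k.
Proof. by rewrite /Delta /bstep; ring. Qed.

End bstep_lemmas.

(** * Entropy along successive Bernoulli steps *)

Section entropy_bstep.
Context {R : realType} (I : set R) (Phi : R -> R).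
Context (I_open : open I) (I_itv : is_interval I).
Context (Phi_smooth : smooth_on I Phi).
Context (Phi_convex : convex_function (I : set (convex_lmodType R^o)) Phi).
Context (A_convex :
  convex_function (T_ I : set (convex_lmodType (R^o * R^o)%type)) (A_ Phi)).
Implicit Types (p h : R) (f : nat -> R).

Lemma energy_ge0 p f k : 0 <= p <= 1 -> (forall k, I (f k)) ->
  0 <= energy Phi p f k.
Proof.
move=> /andP[p0 p1] If; have q0 : 0 <= 1 - p by rewrite subr_ge0.
rewrite /energy addr_ge0// mulr_ge0//.
  by apply: (@A_ge0 _ I) => //; rewrite /Delta addrC subrK.
by apply: (@A_ge0 _ I) => //; rewrite /= ?addrK// /Delta addrC subrK.
Qed.

(** Jensen's inequality: [bstep] commutes with [Delta] and [tau] is linear, so the arguments of [A_]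
    at the averaged function are convex combinations of those at k and k + 1. *)
Lemma energy_bstep_le p h f k : 0 <= p <= 1 -> 0 <= h <= 1 ->
  (forall k, I (f k)) -> energy Phi p (bstep h f) k <= bstep h (energy Phi p f) k.
Proof.
move=> /andP[p0 p1] /andP[h0 h1] If.
have h01 : 0 <= 1 - h <= 1 by lra.
have I1 j : I (f j + Delta f j) by rewrite /Delta addrC subrK.
have I2 j : I (f j + Delta f j + - Delta f j) by rewrite addrK.
have Al := A_convexE A_convex h01 (If k) (I1 k) (If k.+1) (I1 k.+1).
have At := A_convexE A_convex h01 (I1 k) (I2 k) (I1 k.+1) (I2 k.+1).
rewrite /energy Delta_bstep.
have -> : (bstep h f k, bstep h (Delta f) k) = ((1 - h) * f k + (1 - (1 - h)) * f k.+1,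
  (1 - h) * Delta f k + (1 - (1 - h)) * Delta f k.+1).
  by rewrite /bstep; congr pair; ring.
have -> : tau ((1 - h) * f k + (1 - (1 - h)) * f k.+1,
  (1 - h) * Delta f k + (1 - (1 - h)) * Delta f k.+1) =
  ((1 - h) * (f k + Delta f k) + (1 - (1 - h)) * (f k.+1 + Delta f k.+1),
   (1 - h) * - Delta f k + (1 - (1 - h)) * - Delta f k.+1).
  by rewrite /tau/=; congr pair; ring.
have q0 : 0 <= 1 - p by lra.
have := lerD (ler_wpM2l q0 Al) (ler_wpM2l p0 At).
move/le_trans; apply; rewrite le_eqVlt; apply/orP; left; apply/eqP.
by rewrite /bstep /tau/=; ring.
Qed.

Lemma energy_iter_bstep_le n p h f k : 0 <= p <= 1 -> 0 <= h <= 1 ->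
  (forall k, I (f k)) ->
  energy Phi p (iter n (bstep h) f) k <= iter n (bstep h) (energy Phi p f) k.
Proof.
move=> p01 h01 If; elim: n k => // n IH k; rewrite !iterS.
apply: le_trans (bstep_le _ h01 IH); apply: energy_bstep_le => // j.
exact: iter_bstep_interval.
Qed.

(** Chain rule for entropy: [V] and [g] stand for the means of Phi (f) and f over earlier variables,
    and [W] bounds the entropy so far. A new variable averages [W] and adds at most the two-point
    cost of [g]. *)
Lemma entropy_bstep_le h (V W g : nat -> R) k : 0 <= h <= 1 ->
  (forall k, I (g k)) -> (forall k, V k - Phi (g k) <= W k) ->
  bstep h V k - Phi (bstep h g k) <=
  bstep h W k + h * (1 - h) * energy Phi h g k.
Proof.
move=> h01 Ig VW.
have := bernoulli_entropy_le I_open I_itv Phi_smooth A_convex h01 (Ig k) (Ig k.+1).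
have := bstep_le k h01 VW; rewrite /energy -/(Delta g k) /bstep.
move: (A_ _ _) (A_ _ _) (Phi _) (Phi _) (Phi _) => a b c d e; lra.
Qed.

(** Each new variable acts on f averaged over the previous ones, and Jensen moves that average
    outside the energy; hence the mean over n - 1 variables on the right. *)
Lemma entropy_iter_bstep_le n p f k : 0 <= p <= 1 -> (forall k, I (f k)) ->
  iter n (bstep p) (Phi \o f) k - Phi (iter n (bstep p) f k) <=
  n%:R * p * (1 - p) * iter n.-1 (bstep p) (energy Phi p f) k.
Proof.
move=> p01 If; elim: n k => [|n IH] k; first by rewrite /= subrr !mul0r.
rewrite !iterS; apply: le_trans.
  apply: (entropy_bstep_le _ p01 _ IH) => j; exact: iter_bstep_interval.
have pq0 : 0 <= p * (1 - p) by move: p01 => /andP[? ?]; rewrite mulr_ge0// subr_ge0.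
have /(ler_wpM2l pq0) := energy_iter_bstep_le n k p01 p01 If.
(* For n = 0 the truncated [n.-1] spoils the match between the averaged earlier term and the new
   iterate, but that term has coefficient 0. *)
case: n IH => [_|n IH /=]; first by rewrite /= /bstep; lra.
move/(lerD (lexx (bstep p (fun k => n.+1%:R * p * (1 - p) *
  iter n (bstep p) (energy Phi p f) k) k))).
move/le_trans; apply.
by rewrite -[in n.+2%:R]addn1 natrD /bstep; lra.
Qed.

(** The binomial cost is the base case; each further step of parameter h averages the bound obtained
    so far and adds its own cost. *)
Lemma entropy_iter_iter_bstep_le n N p h f k : 0 <= p <= 1 -> 0 <= h <= 1 ->
  (forall k, I (f k)) ->
  iter N (bstep h) (iter n (bstep p) (Phi \o f)) k -
  Phi (iter N (bstep h) (iter n (bstep p) f) k) <=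
  N%:R * h * iter N (bstep h) (iter n (bstep p) (energy Phi h f)) k +
  n%:R * p * (1 - p) *
    iter N (bstep h) (iter n.-1 (bstep p) (energy Phi p f)) k.
Proof.
move=> p01 h01 If; elim: N k => [|N IH] k.
  by rewrite /= !mul0r add0r; exact: entropy_iter_bstep_le.
have Ig m j : I (iter m (bstep h) (iter n (bstep p) f) j).
  by apply: iter_bstep_interval => // i; exact: iter_bstep_interval.
rewrite !iterS; apply: le_trans; first exact: (entropy_bstep_le _ h01 _ IH).
rewrite bstep_lin -natr1.
set E := iter N (bstep h) (iter n (bstep p) (energy Phi h f)).
set g := iter N (bstep h) (iter n (bstep p) f).
have gE j : energy Phi h g j <= E j.
  apply: le_trans (energy_iter_bstep_le _ _ _ _ _) _ => //.
    by move=> i; exact: iter_bstep_interval.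
  by apply: iter_bstep_le => // i; exact: energy_iter_bstep_le.
have E0 j : 0 <= E j.
  by do 2!(apply: iter_bstep_ge0 => // ?); exact: energy_ge0.
case/andP: h01 => h0 h1.
(* The factor 1 - h is traded for one more average: (1 - h) E k is the first summand of
   [bstep h E k], and the other is nonnegative. *)
suff : h * (1 - h) * energy Phi h g k <= h * bstep h E k.
  move: (bstep h E k) (bstep h _ k) (energy _ _ _ _) => a b c; lra.
rewrite -mulrA ler_wpM2l// /bstep.
apply: le_trans (ler_wpM2l _ (gE k)) _; first by rewrite subr_ge0.
by rewrite lerDl mulr_ge0.
Qed.

End entropy_bstep.

(** * Binomial weights and their Poisson limit *)

Section poisson_limit.
Context {R : realType}.
Implicit Types (p c rho : R) (F G : nat -> R).

Lemma bstepC p h F : bstep p (bstep h F) = bstep h (bstep p F).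
Proof. by apply/funext => k; rewrite /bstep; ring. Qed.

(** The entropy bound applies the steps of parameter h last; moving them inside lets the Poisson
    limit be taken before the binomial average. *)
Lemma iter_bstepC n N p h F :
  iter N (bstep h) (iter n (bstep p) F) = iter n (bstep p) (iter N (bstep h) F).
Proof.
elim: N => // N IH; rewrite iterS IH; elim: {IH}n => // n IH.
by rewrite !iterS -IH bstepC.
Qed.

Lemma cvg_iter_bstep n p (u : nat -> nat -> R) G k :
  (forall k, u N k @[N --> \oo] --> G k) ->
  iter n (bstep p) (u N) k @[N --> \oo] --> iter n (bstep p) G k.
Proof.
move=> uG; elim: n k => // n IH k; rewrite iterS.
by apply: cvgD; apply: cvgMl_tmp; exact: IH.
Qed.

Lemma binomial_pmfS0 n p : binomial_pmf n.+1 p 0 = (1 - p) * binomial_pmf n p 0.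
Proof. by rewrite /binomial_pmf !subn0 !bin0 !mulr1n exprS /unstable.onem; ring. Qed.

Lemma binomial_pmfSS n p k :
  binomial_pmf n.+1 p k.+1 = (1 - p) * binomial_pmf n p k.+1 + p * binomial_pmf n p k.
Proof.
rewrite /binomial_pmf subSS -(mulr_natr _ 'C(n.+1, k.+1)).
rewrite -(mulr_natr _ 'C(n, k.+1)) -(mulr_natr _ 'C(n, k)) binS natrD.
(* For n <= k the exponent n - (k + 1) is truncated, but its coefficient ['C(n, k.+1)] is 0. *)
have [kn|nk] := ltnP k n; last first.
  by rewrite (@bin_small n k.+1)// exprS /unstable.onem; ring.
by rewrite -[in (n - k)%N](@subnSK k n)// !exprS /unstable.onem; ring.
Qed.

Lemma iter_bstep_binomial n p F i : iter n (bstep p) F i =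
  \sum_(k < n.+1) binomial_pmf n p k * F (i + k)%N.
Proof.
elim: n i => [|n IH] i.
  by rewrite big_ord1 /binomial_pmf bin0 addn0 !expr0 !mul1r.
rewrite iterS /bstep !IH [in RHS]big_ord_recl/= binomial_pmfS0 addn0.
rewrite [in LHS]big_ord_recl/= addn0.
under [in RHS]eq_bigr do rewrite /bump/= add1n binomial_pmfSS mulrDl.
rewrite big_split/= [X in _ = _ + (X + _)]big_ord_recr/=.
have -> : binomial_pmf n p n.+1 = 0 by rewrite /binomial_pmf bin_small.
rewrite !mulrDr !mulr_sumr mulr0 mul0r addr0 !addrA; congr (_ + _ + _).
- by rewrite mulrA.
- by apply: eq_bigr => k _; rewrite /bump/= add1n mulrA.
- by apply: eq_bigr => k _; rewrite mulrA addSnnS.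
Qed.

Definition poisson_weight rho k := rho ^+ k / k`!%:R * expR (- rho).

(** With h = rho / (N + 1), the bound 1 + x <= e^x at x = -h and at x = h / (1 - h) places 1 - h
    between e^(-h / (1 - h)) and e^(-h); then take powers N + 1 and squeeze. *)
Lemma cvg_one_sub_expR rho : 0 <= rho ->
  (1 - rho * harmonic N) ^+ N.+1 @[N --> \oo] --> expR (- rho).
Proof.
move=> rho0.
have h0 : rho * harmonic N @[N --> \oo] --> 0.
  by rewrite -[X in _ --> X](mulr0 rho); apply: cvgMl_tmp; exact: cvg_harmonic.
have hE N : rho * harmonic N * N.+1%:R = rho by rewrite /harmonic/= mulfVK.
apply: (@squeeze_cvgr _ _ _ _ (fun N => expR (- rho / (1 - rho * harmonic N)))
    (fun=> expR (- rho))); last 2 first.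
- rewrite -[in X in _ --> X](divr1 (- rho)).
  apply: continuous_cvg; first exact: continuous_expR.
  apply: cvgMl_tmp; apply: cvgV; first exact: oner_neq0.
  by rewrite -[X in _ --> X]subr0; apply: cvgB => //; exact: cvg_cst.
- exact: cvg_cst.
near=> N.
have hN1 : rho * harmonic N < 1 by near: N; exact: (cvgr_lt 0).
have hN0 : 0 <= rho * harmonic N by rewrite mulr_ge0// harmonic_ge0.
move: (hE N) hN1 hN0; move: (rho * harmonic N) => h hr h1 h0'.
have q0 : 0 < 1 - h by rewrite subr_gt0.
rewrite -hr; apply/andP; split.
  rewrite -mulNr mulrAC expRM_natr lerXn2r ?nnegrE ?expR_ge0 ?(ltW q0)//.
  rewrite mulNr expRN -[leRHS]invrK lef_pV2 ?posrE ?expR_gt0 ?invr_gt0//.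
  apply: le_trans (expR_ge1Dx _); rewrite le_eqVlt; apply/orP; left.
  by apply/eqP; field; rewrite lt0r_neq0.
rewrite -mulNr expRM_natr lerXn2r ?nnegrE ?expR_ge0 ?(ltW q0)//.
exact: expR_ge1Dx.
Unshelve. all: by end_near.
Qed.

(** Induction on k: with h = rho / (N + 1), the ratio of consecutive weights is (N + 1 - k) h / ((k
    + 1) (1 - h)), which tends to rho / (k + 1). *)
Lemma cvg_binomial_poisson rho k : 0 <= rho ->
  binomial_pmf N.+1 (rho * harmonic N) k @[N --> \oo] --> poisson_weight rho k.
Proof.
move=> rho0.
have h0 : rho * harmonic N @[N --> \oo] --> 0.
  by rewrite -[X in _ --> X](mulr0 rho); apply: cvgMl_tmp; exact: cvg_harmonic.
have hE N : N.+1%:R * (rho * harmonic N) = rho.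
  by rewrite /harmonic/= mulrCA mulfV// mulr1.
elim: k => [|k IH].
  rewrite /poisson_weight fact0 divr1 mul1r.
  rewrite (_ : (fun N => _) = (fun N => (1 - rho * harmonic N) ^+ N.+1)).
    exact: cvg_one_sub_expR.
  by apply/funext => N; rewrite /binomial_pmf bin0 subn0 mul1r.
have -> : poisson_weight rho k.+1 =
    (rho - k%:R * 0) / k.+1%:R / (1 - 0) * poisson_weight rho k.
  rewrite /poisson_weight factS natrM exprS; field.
  by rewrite !pnatr_eq0 -lt0n fact_gt0 nat1r pnatr_eq0.
have lim_rec : (rho - k%:R * (rho * harmonic N)) / k.+1%:R /
    (1 - rho * harmonic N) * binomial_pmf N.+1 (rho * harmonic N) k @[N --> \oo] -->
    (rho - k%:R * 0) / k.+1%:R / (1 - 0) * poisson_weight rho k.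
  apply: cvgM IH; apply: cvgM; last first.
    apply: cvgV; first by rewrite subr0 oner_neq0.
    by apply: cvgB; [exact: cvg_cst|exact: h0].
  apply: cvgM; last exact: cvg_cst.
  by apply: cvgB; [exact: cvg_cst|apply: cvgMl_tmp; exact: h0].
apply: cvg_trans lim_rec.
apply: near_eq_cvg; near=> N.
have hN1 : rho * harmonic N < 1 by near: N; exact: (cvgr_lt 0).
have kN : (k < N.+1)%N by near: N; exists k.
rewrite -{1}(hE N) -mulrBl -natrB; last exact: ltnW.
move: (rho * harmonic N) hN1 => h h1.
have binE : 'C(N.+1, k.+1)%:R = (N.+1 - k)%:R * 'C(N.+1, k)%:R / k.+1%:R :> R.
  by rewrite -natrM -mul_bin_left natrM mulrC mulKf// pnatr_eq0.
rewrite /binomial_pmf -(mulr_natr _ 'C(N.+1, k.+1)) binE -(mulr_natr _ 'C(N.+1, k)).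
have -> : (1 - h) ^+ (N.+1 - k) = (1 - h) * (1 - h) ^+ (N.+1 - k.+1).
  by rewrite -exprS subnSK.
rewrite exprS /unstable.onem; move: (_ ^+ (N.+1 - k.+1)) (_ %:R) => a b.
field; rewrite nat1r pnatr_eq0/= subr_eq0 gt_eqF//.
Unshelve. all: by end_near.
Qed.

End poisson_limit.

(** * Averages and integrals of eventually constant functions *)

Section eventually_constant.
Context {R : realType}.
Implicit Types (p c rho : R) (F : nat -> R).

Lemma sum_nat_support (n m : nat) (G : nat -> R) : (m <= n)%N ->
  (forall k, (m <= k)%N -> G k = 0) -> \sum_(k < n) G k = \sum_(k < m) G k.
Proof.
move=> mn G0; rewrite -(big_mkord xpredT G) (big_cat_nat (n := m))//=.
rewrite (_ : \sum_(m <= i < n) G i = 0) ?addr0 ?big_mkord//.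
rewrite big_nat_cond big1// => k; rewrite andbT => /andP[mk _]; exact: G0.
Qed.

Lemma iter_bstep_cst n p c k : iter n (bstep p) (fun=> c) k = c.
Proof. by elim: n k => // n IH k; rewrite iterS /bstep !IH; ring. Qed.

(** Subtracting the eventual value c leaves a sum whose range does not grow with n, so the weights
    can pass to the limit one by one. *)
Lemma iter_bstep_binomial_cst n p c m F i : (m <= n.+1)%N ->
  (forall k, (m <= k)%N -> F k = c) ->
  iter n (bstep p) F i = c + \sum_(k < m) binomial_pmf n p k * (F (i + k)%N - c).
Proof.
move=> mn Fc.
have -> : iter n (bstep p) F i = c + iter n (bstep p) (fun k => F k - c) i.
  have FE : F = (fun k => c * 1 + 1 * (F k - c)) by apply/funext => k; ring.
  by rewrite [in LHS]FE iter_bstep_lin iter_bstep_cst mulr1 mul1r.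
rewrite iter_bstep_binomial; congr (_ + _).
apply: (sum_nat_support (G := fun k => binomial_pmf n p k * (F (i + k)%N - c))) => // k mk.
by rewrite Fc ?subrr ?mulr0// (leq_trans mk)// leq_addl.
Qed.

Lemma cvg_iter_bstep_poisson rho c m F i : 0 <= rho ->
  (forall k, (m <= k)%N -> F k = c) ->
  iter N.+1 (bstep (rho * harmonic N)) F i @[N --> \oo] -->
  c + \sum_(k < m) poisson_weight rho k * (F (i + k)%N - c).
Proof.
move=> rho0 Fc.
have lim : c + \sum_(k < m) binomial_pmf N.+1 (rho * harmonic N) k * (F (i + k)%N - c)
    @[N --> \oo] --> c + \sum_(k < m) poisson_weight rho k * (F (i + k)%N - c).
  apply: cvgD; first exact: cvg_cst.
  elim: {Fc}m => [|m IH].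
    rewrite big_ord0 (_ : (fun N => _) = (fun=> 0)); first exact: cvg_cst.
    by apply/funext => N; rewrite big_ord0.
  rewrite big_ord_recr (_ : (fun N => _) = (fun N => \sum_(k < m)
      binomial_pmf N.+1 (rho * harmonic N) k * (F (i + k)%N - c) +
      binomial_pmf N.+1 (rho * harmonic N) m * (F (i + m)%N - c))).
    apply: cvgD; first exact: IH.
    by apply: cvgMr_tmp; exact: cvg_binomial_poisson.
  by apply/funext => N; rewrite big_ord_recr.
apply: cvg_trans lim; apply: near_eq_cvg; near=> N.
apply/esym/iter_bstep_binomial_cst => //; apply/leqW/leqW.
by near: N; exists m.
Unshelve. all: by end_near.
Qed.

(** Induction on m: resetting the value at m to c changes the function by a multiple of the
    indicator of {m}. *)
Lemma integral_eventually_cst (Q : probability nat R) c m F :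
  (forall k, (m <= k)%N -> F k = c) ->
  Q.-integrable [set: nat] (EFin \o F) /\
  (\int[Q]_k (F k)%:E = (c + \sum_(k < m) fine (Q [set k : nat]) * (F k - c))%:E)%E.
Proof.
elim: m F => [|m IH] F Fc.
  have -> : F = (fun=> c) by apply/funext => k; exact: Fc.
  split; first exact: finite_measure_integrable_cst.
  by rewrite big_ord0 addr0 integral_cst//= probability_setT mule1.
pose G k := if k == m then c else F k.
have [|iG vG] := IH G.
  move=> k mk; rewrite /G; case: eqP => // /eqP km; apply: Fc.
  by rewrite ltn_neqAle eq_sym km.
have FE k : (F k)%:E = ((G k)%:E + (F m - c)%:E * (\1_[set m] k)%:E)%E.
  rewrite /G indicE -EFinM -EFinD; case: eqP => [->|km].
    by rewrite mem_set// mulr1 addrC subrK.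
  by rewrite memNset//= mulr0 addr0.
have iI : Q.-integrable [set: nat] (EFin \o \1_[set m]).
  by apply: integrable_indic => //; rewrite -ge0_fin_numE// fin_num_measure.
have -> : EFin \o F = ((EFin \o G) \+ (fun k => (F m - c)%:E * (EFin \o \1_[set m]) k))%E.
  by apply/funext => k; exact: FE.
split; first by apply: integrableD => //; exact: integrableZl.
under eq_integral do rewrite FE.
rewrite integralD//; last exact: integrableZl.
rewrite vG integralZl// integral_indic// setIT.
rewrite -[X in (_ * X)%E](fineK (fin_num_measure Q _ _))// -EFinM -EFinD.
rewrite big_ord_recr/= addrA [(F m - c) * _]mulrC; congr (_ + _ + _)%:E.
by apply: eq_bigr => k _; rewrite /G ltn_eqF.
Qed.

End eventually_constant.

(** * Means under the binomial-Poisson law *)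

Section binomial_poisson_mean.
Context {R : realType}.
Implicit Types (p c rho : R) (F : nat -> R).

Lemma poisson_prob_set1 rho k : 0 <= rho ->
  poisson_prob rho 0 [set k] = (poisson_weight rho k)%:E.
Proof.
move=> rho0; rewrite /poisson_prob /poisson_weight; case: ifPn => [rho_gt0|].
  rewrite esum_set1; first by rewrite /poisson_pmf rho_gt0.
  by rewrite lee_fin poisson_pmf_ge0.
(* At rho = 0 the law is the Dirac mass at 0, and the weights agree with it because 0^0 = 1. *)
rewrite lt_neqAle rho0 andbT negbK => /eqP <-.
rewrite oppr0 expR0 mulr1 diracE; case: k => [|k].
  by rewrite mem_set// fact0 divr1.
by rewrite memNset// exprS !mul0r.
Qed.

Lemma ge0_integral_convolution (P Q : probability nat R) (g : nat -> \bar R) :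
  (forall k, 0 <= g k)%E ->
  (\int[convolution P Q]_k g k = \int[P]_i \int[Q]_j g (i + j)%N)%E.
Proof.
move=> g0; rewrite /convolution ge0_integral_distribution//.
rewrite (@fubini_tonelli1 _ _ _ _ _ P Q (g \o addn_pair))//; last first.
  by move=> x; exact: g0.
by move=> _ B _; rewrite comp_preimage; exact: measurable_addn_pair.
Qed.

Lemma expectation_eventually_cst_shift (Q : probability nat R) a c m F :
  (forall k, (m <= k)%N -> F k = c) ->
  fine 'E_Q[fun k => F k + a] = fine 'E_Q[F] + a.
Proof.
move=> Fc; have Fac k : (m <= k)%N -> F k + a = c + a by move=> /Fc ->.
rewrite unlock (integral_eventually_cst Q Fc).2 (integral_eventually_cst Q Fac).2/=.
rewrite -!addrA [in RHS](addrC _ a); congr (_ + (_ + _)).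
by apply: eq_bigr => k _; rewrite opprD addrACA subrr addr0.
Qed.

Lemma ge0_expectation_binomial_poisson p rho n c m F :
  0 <= p <= 1 -> 0 <= rho -> (forall k, 0 <= F k) ->
  (forall k, (m <= k)%N -> F k = c) ->
  fine 'E_(binomial_poisson p rho n)[F] = iter n (bstep p)
    (fun i => c + \sum_(k < m) poisson_weight rho k * (F (i + k)%N - c)) 0%N.
Proof.
move=> /andP[p0 p1] rho0 F0 Fc; rewrite unlock /binomial_poisson.
rewrite ge0_integral_convolution//.
rewrite (@integral_binomial _ n p p0 p1 (fun i =>
   \int[poisson_prob rho 0]_j (F (i + j)%N)%:E)%E); last first.
  by move=> i; apply: integral_ge0 => j _; rewrite lee_fin.
rewrite iter_bstep_binomial.
rewrite [X in fine X](_ : _ = (\sum_(k < n.+1) binomial_pmf n p k *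
  (c + \sum_(j < m) poisson_weight rho j * (F (0 + k + j)%N - c)))%:E)//.
rewrite -sumEFin; apply: eq_bigr => i _.
have Fic k : (m <= k)%N -> F (i + k)%N = c.
  by move=> mk; rewrite Fc// (leq_trans mk)// leq_addl.
rewrite (integral_eventually_cst _ Fic).2 -EFinM; congr (_ * (_ + _))%:E.
apply: eq_bigr => j _; congr (_ * _).
exact: (congr1 (@fine R) (@poisson_prob_set1 rho j rho0)).
Qed.

Lemma cvg_binomial_poisson_mean p rho n c m F :
  0 <= p <= 1 -> 0 <= rho -> (forall k, (m <= k)%N -> F k = c) ->
  iter n (bstep p) (iter N.+1 (bstep (rho * harmonic N)) F) 0%N @[N --> \oo] -->
  fine 'E_(binomial_poisson p rho n)[F].
Proof.
move=> p01 rho0 Fc.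
(* F takes only the value c and its values below m, so [a] bounds |F| and F + a is nonnegative, as
   the Tonelli formula asks; averaging fixes constants, so the shift cancels. *)
pose a : R := `|c| + \sum_(k < m) `|F k|.
have Fa k : 0 <= F k + a.
  have Fka : `|F k| <= a.
    have [km|mk] := ltnP k m.
      rewrite /a (bigD1 (Ordinal km))//= addrCA lerDl addr_ge0// sumr_ge0//.
    by rewrite Fc// lerDl sumr_ge0.
  by move: Fka; rewrite ler_norml => /andP[]; lra.
have -> : fine 'E_(binomial_poisson p rho n)[F] =
    fine 'E_(binomial_poisson p rho n)[fun k => F k + a] - a.
  by rewrite (@expectation_eventually_cst_shift _ a c m)// addrK.
rewrite (@ge0_expectation_binomial_poisson _ _ _ (c + a) m)// => [|k mk]; last first.
  by rewrite Fc.
have lim i : iter N.+1 (bstep (rho * harmonic N)) F i @[N --> \oo] -->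
  c + \sum_(k < m) poisson_weight rho k * (F (i + k)%N - c).
  exact: cvg_iter_bstep_poisson.
have := cvg_iter_bstep (n := n) (p := p) (k := 0%N) lim.
suff -> : iter n (bstep p)
    (fun i => c + \sum_(k < m) poisson_weight rho k * (F (i + k)%N - c)) 0%N =
  iter n (bstep p) (fun i => c + a + \sum_(k < m) poisson_weight rho k *
    (F (i + k)%N + a - (c + a))) 0%N - a by [].
apply/eqP; rewrite -subr_eq opprK; apply/eqP.
rewrite -[X in _ + X](iter_bstep_cst n p a 0%N) -[X in X + _]mul1r -[X in _ + X]mul1r.
rewrite -iter_bstep_lin; congr (iter n (bstep p) _ _); apply/funext => i.
rewrite !mul1r addrAC; congr (_ + _ + _)%R; apply: eq_bigr => k _.
by rewrite opprD addrACA subrr addr0.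
Qed.

End binomial_poisson_mean.

(** * Integrals over the natural numbers and truncation *)

Section integrals_on_nat.
Context {R : realType} (Q : probability nat R).
Implicit Types (f g : nat -> R) (c : R).

Lemma fine_expectationK f : Q.-integrable [set: nat] (EFin \o f) ->
  ('E_Q[f] = (fine 'E_Q[f])%:E)%E.
Proof. by move=> fi; rewrite unlock fineK//; exact: integrable_fin_num. Qed.

(** [H] may have infinite mean, so the right side stays an extended real; this serves the energies
    of a general f. *)
Lemma ge0_fine_expectation_le (G H : nat -> R) :
  Q.-integrable [set: nat] (EFin \o G) -> (forall k, 0 <= G k) ->
  (forall k, G k <= H k) -> ((fine 'E_Q[G])%:E <= 'E_Q[H])%E.
Proof.
move=> Gi G0 GH; rewrite -fine_expectationK// unlock; apply: ge0_le_integral => //.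
  by move=> k _; rewrite lee_fin.
by move=> k _; rewrite lee_fin.
Qed.

(** If the mean were at most c, the positive function f - c would have integral 0 and vanish almost
    everywhere, although Q has mass 1. *)
Lemma expectation_gt f c : Q.-integrable [set: nat] (EFin \o f) ->
  (forall k, c < f k) -> c < fine 'E_Q[f].
Proof.
move=> fi cf; rewrite ltNge; apply/negP => Ec.
have intE : (\int[Q]_k `|(f k)%:E - c%:E|)%E = (fine 'E_Q[f] - c)%:E.
  under eq_integral do rewrite -EFinB gee0_abs ?lee_fin ?subr_ge0 ?(ltW (cf _))// EFinB.
  rewrite (integralB_EFin _ fi)//; last exact: finite_measure_integrable_cst.
  rewrite integral_cst//= probability_setT mule1 EFinB; congr (_ - _)%E.
  by rewrite -fine_expectationK// unlock.
have int0 : (\int[Q]_k `|(f k)%:E - c%:E|)%E = 0%E.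
  apply/eqP; rewrite eq_le integral_ge0 ?andbT; last by move=> *; exact: abse_ge0.
  by rewrite intE lee_fin subr_le0.
have [//|N [_ QN0 subN]] := (ae_eq_integral_abs Q measurableT _).1 int0.
have : Q [set: nat] = 0%E.
  rewrite -QN0; congr (Q _); apply/seteqP; split => // k _; apply: subN => /=.
  move=> /(_ I) /eqP; rewrite -EFinB eqe subr_eq0 gt_eqF//.
by rewrite probability_setT => /eqP; rewrite onee_eq0.
Qed.

(** If the mean lay outside I, all f k would lie strictly on one side of it because I is an
    interval, against the strict comparison with the mean. *)
Lemma expectation_interval (I : set R) f : is_interval I ->
  (forall k, I (f k)) -> Q.-integrable [set: nat] (EFin \o f) ->
  I (fine 'E_Q[f]).
Proof.
move=> I_itv If fi; apply: contrapT => nIE.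
have fE k : f k != fine 'E_Q[f].
  by apply/eqP => fkE; apply: nIE; rewrite -fkE.
have [lt0E|gt0E] : f 0%N < fine 'E_Q[f] \/ fine 'E_Q[f] < f 0%N.
  by move: (fE 0%N); rewrite neq_lt => /orP.
- have fNi : Q.-integrable [set: nat] (EFin \o (fun k => - f k)).
    by have := integrableN fi; apply: eq_integrable.
  have : fine 'E_Q[fun k => - f k] = - fine 'E_Q[f].
    rewrite unlock -fineN -integralN//; last exact: integrable_add_def.
  suff : - fine 'E_Q[f] < fine 'E_Q[fun k => - f k] by move=> /[swap] ->; rewrite ltxx.
  apply: expectation_gt => // k; rewrite ltrN2 lt_neqAle fE/= leNgt.
  apply/negP => Efk; apply: nIE; apply: (I_itv (f 0%N) (f k)) => //.
  by rewrite !ltW.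
- suff : fine 'E_Q[f] < fine 'E_Q[f] by rewrite ltxx.
  apply: expectation_gt => // k; rewrite lt_neqAle eq_sym fE/= leNgt.
  apply/negP => Efk; apply: nIE; apply: (I_itv (f k) (f 0%N)) => //.
  by rewrite !ltW.
Qed.

Lemma cvg_expectation_truncation f g (M : nat -> nat) :
  (forall j, (j <= M j)%N) -> Q.-integrable [set: nat] (EFin \o f) ->
  Q.-integrable [set: nat] (EFin \o g) ->
  (forall j k, `|f (minn k (M j))| <= g k) ->
  fine 'E_Q[fun k => f (minn k (M j))] @[j --> \oo] --> fine 'E_Q[f].
Proof.
move=> jM fi gi fg; apply: fine_cvg; rewrite -fine_expectationK// unlock.
apply: (@dominated_cvg _ _ _ Q setT _ _ _ (EFin \o g)) => //; last first.
  by move=> j k _ /=; rewrite lee_fin; exact: fg.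
move=> k _; apply: cvg_near_cst; exists k => //= j kj.
by rewrite (minn_idPl _)// (leq_trans kj).
Qed.

End integrals_on_nat.

(* Choosing the truncation level m near the infimum of g over the tail makes
   g (m) dominated by g + 1 on that tail. *)
Lemma truncation_levels (R : realType) (g : nat -> R) : (forall k, 0 <= g k) ->
  exists M : nat -> nat, forall j,
    (j <= M j)%N /\ forall k, g (minn k (M j)) <= g k + 1.
Proof.
move=> g0.
suff H j : exists m, (j <= m)%N /\ forall k, g (minn k m) <= g k + 1.
  by have [M HM] := choice H; exists M.
pose S := [set g k | k in [set k | (j <= k)%N]].
have S0 : lbound S 0 by move=> _ [k _ <-].
have Sinf : has_inf S by split; [exists (g j); exists j => //=|exists 0].
have [_ [m /= jm <-] gm] := inf_adherent ltr01 Sinf.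
exists m; split => // k; have [km|mk] := leqP k m; first by rewrite lerDl.
apply: (le_trans (ltW gm)); rewrite lerD2r; apply: ge_inf; first by exists 0.
by exists k => //=; rewrite (leq_trans jm)// ltnW.
Qed.

(** * The entropy inequality, for eventually constant and then for general functions *)

Lemma A_0 (R : realType) (Phi : R -> R) (u : R) : A_ Phi (u, 0) = 0.
Proof. by rewrite /A_/= addr0 subrr mulr0 subrr. Qed.

Lemma tau_0 (R : realType) (u : R) : tau (u, 0) = (u, 0).
Proof. by rewrite /tau/= addr0 oppr0. Qed.

Lemma smooth_on_continuous (R : realType) (I : set R) (Phi : R -> R) (x : R) :
  smooth_on I Phi -> I x -> {for x, continuous Phi}.
Proof.
move=> sm Ix; have [dPhi _] := smooth_on_is_derive 0 sm Ix.
by apply: differentiable_continuous; apply/derivable1_diffP; exact: dPhi.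
Qed.

Section entropy_binomial_poisson.
Context {R : realType} (I : set R) (Phi : R -> R).
Context (I_open : open I) (I_itv : is_interval I).
Context (Phi_smooth : smooth_on I Phi).
Context (Phi_convex : convex_function (I : set (convex_lmodType R^o)) Phi).
Context (A_convex :
  convex_function (T_ I : set (convex_lmodType (R^o * R^o)%type)) (A_ Phi)).
Context (p rho : R) (p01 : 0 <= p <= 1) (rho0 : 0 <= rho).

Lemma entropy_eventually_cst_le n m (c : R) (f : nat -> R) :
  (forall k, I (f k)) -> (forall k, (m <= k)%N -> f k = c) ->
  fine 'E_(binomial_poisson p rho n)[Phi \o f] -
    Phi (fine 'E_(binomial_poisson p rho n)[f]) <=
  rho * fine 'E_(binomial_poisson p rho n)[fun k => A_ Phi (f k, Delta f k)] +
  n%:R * p * (1 - p) * fine 'E_(binomial_poisson p rho n.-1)[energy Phi p f].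
Proof.
move=> If fc.
have Df0 k : (m <= k)%N -> Delta f k = 0.
  by move=> mk; rewrite /Delta !fc ?subrr// leqW.
pose A k : R := A_ Phi (f k, Delta f k).
pose T k : R := A_ Phi (tau (f k, Delta f k)).
have Phifc k : (m <= k)%N -> (Phi \o f) k = Phi c by move=> /fc/= ->.
have Ac k : (m <= k)%N -> A k = 0 by move=> /Df0 Dk; rewrite /A Dk A_0.
have Tc k : (m <= k)%N -> T k = 0 by move=> /Df0 Dk; rewrite /T Dk tau_0 A_0.
have Ec k : (m <= k)%N -> energy Phi p f k = 0.
  by move=> mk; rewrite /energy -/(A k) -/(T k) Ac// Tc//; ring.
have lim d F := @cvg_binomial_poisson_mean R p rho n d m F p01 rho0.
have lim' d F := @cvg_binomial_poisson_mean R p rho n.-1 d m F p01 rho0.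
have h0 : rho * harmonic N @[N --> \oo] --> 0.
  by rewrite -[X in _ --> X](mulr0 rho); apply: cvgMl_tmp; exact: cvg_harmonic.
have IEf : I (fine 'E_(binomial_poisson p rho n)[f]).
  apply: expectation_interval => //.
  exact: (integral_eventually_cst _ fc).1.
have cPhi : {for fine 'E_(binomial_poisson p rho n)[f], continuous Phi}.
  exact: smooth_on_continuous Phi_smooth IEf.
pose S F N := iter n (bstep p) (iter N.+1 (bstep (rho * harmonic N)) F) 0%N.
pose S' F N := iter n.-1 (bstep p) (iter N.+1 (bstep (rho * harmonic N)) F) 0%N.
have limL : S (Phi \o f) N - Phi (S f N) @[N --> \oo] -->
    fine 'E_(binomial_poisson p rho n)[Phi \o f] -
    Phi (fine 'E_(binomial_poisson p rho n)[f]).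
  by apply: cvgB; [exact: lim Phifc|apply: continuous_cvg => //; exact: lim fc].
(* The energy with parameter h splits as (1 - h) A + h T; the means of T converge, so the second
   part vanishes with h. *)
have limR : rho * ((1 - rho * harmonic N) * S A N + rho * harmonic N * S T N) +
      n%:R * p * (1 - p) * S' (energy Phi p f) N @[N --> \oo] -->
    rho * ((1 - 0) * fine 'E_(binomial_poisson p rho n)[A] +
      0 * fine 'E_(binomial_poisson p rho n)[T]) +
    n%:R * p * (1 - p) * fine 'E_(binomial_poisson p rho n.-1)[energy Phi p f].
  apply: cvgD; apply: cvgMl_tmp; last exact: lim' Ec.
  apply: cvgD; apply: cvgM; [|exact: lim Ac|exact: h0|exact: lim Tc].
  by apply: cvgB; [exact: cvg_cst|exact: h0].
rewrite subr0 mul1r mul0r addr0 in limR.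
apply: (ler_cvg_to limL limR); near=> N.
have h1 : rho * harmonic N <= 1 by near: N; exact: (cvgr_le 0).
set h := rho * harmonic N in h1 *.
have h01 : 0 <= h <= 1 by rewrite h1 mulr_ge0// harmonic_ge0.
have := @entropy_iter_iter_bstep_le R I Phi I_open I_itv Phi_smooth Phi_convex
  A_convex n N.+1 p h f 0%N p01 h01 If.
have -> : N.+1%:R * h = rho by rewrite /h /harmonic/= mulrCA mulfV// mulr1.
have -> : iter n (bstep p) (energy Phi h f) =
    fun k => (1 - h) * iter n (bstep p) A k + h * iter n (bstep p) T k.
  by apply/funext => k; rewrite -iter_bstep_lin.
by rewrite iter_bstep_lin !(iter_bstepC n N.+1 p h) (iter_bstepC n.-1 N.+1 p h).
Unshelve. all: by end_near.
Qed.

End entropy_binomial_poisson.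

Theorem corollary2p5 (R : realType) (I : set R) (Phi : R -> R)
  (I_open : open I) (I_itv : is_interval I)
  (Phi_smooth : smooth_on I Phi)
  (Phi_convex : convex_function (I : set (convex_lmodType R^o)) Phi)
  (A_convex :
    convex_function (T_ I : set (convex_lmodType (R^o * R^o)%type)) (A_ Phi))
  (p rho : R) (p_ge0 : 0 <= p) (p_le1 : p <= 1) (rho_ge0 : 0 <= rho)
  (n : nat) (f : nat -> R)
  (f_L1Phi : L1Phi I Phi (binomial_poisson p rho n) f) :
  let q := 1 - p in
  let M := binomial_poisson p rho in
  (Ent Phi (M n) f <=
     rho%:E * 'E_(M n)[fun k => A_ Phi (f k, Delta f k)] +
     (n%:R * p * q)%:E *
       'E_(M n.-1)[fun k => (q * A_ Phi (f k, Delta f k) +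
                             p * A_ Phi (tau (f k, Delta f k)))%R])%E.
Proof.
cbv zeta; set q := 1 - p; pose M := binomial_poisson p rho.
have [If fi Phifi] := f_L1Phi.
have p01 : 0 <= p <= 1 by rewrite p_ge0.
have pq0 : 0 <= n%:R * p * q by rewrite !mulr_ge0// subr_ge0.
(* Levels chosen for the sum |f| + |Phi (f)| let one integrable [g] dominate the truncations of both
   f and Phi (f). *)
have [L HL] := @truncation_levels R (fun k => `|f k| + `|Phi (f k)|)
  (fun k => addr_ge0 (normr_ge0 _) (normr_ge0 _)).
pose g k := `|f k| + `|Phi (f k)| + 1.
have gi : (M n).-integrable [set: nat] (EFin \o g).
  have i1 := integrable_norm fi; have i2 := integrable_norm Phifi.
  have i3 : (M n).-integrable [set: nat] (EFin \o cst 1).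
    exact: finite_measure_integrable_cst.
  have := integrableD measurableT (integrableD measurableT i1 i2) i3.
  by apply: eq_integrable.
pose F j k := f (minn k (L j)).
have limf : fine 'E_(M n)[F j] @[j --> \oo] --> fine 'E_(M n)[f].
  apply: (@cvg_expectation_truncation _ _ _ g) => // j; first by have [] := HL j.
  by move=> k; have [_ /(_ k)] := HL j; apply: le_trans; rewrite lerDl.
have limPhi : fine 'E_(M n)[Phi \o F j] @[j --> \oo] --> fine 'E_(M n)[Phi \o f].
  apply: (@cvg_expectation_truncation _ _ (Phi \o f) g) => // j; first by have [] := HL j.
  by move=> k; have [_ /(_ k)] := HL j; apply: le_trans; rewrite lerDr.
have IEf : I (fine 'E_(M n)[f]) by exact: expectation_interval.
have cPhi : {for fine 'E_(M n)[f], continuous Phi}.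
  exact: smooth_on_continuous Phi_smooth IEf.
have lim : fine 'E_(M n)[Phi \o F j] - Phi (fine 'E_(M n)[F j]) @[j --> \oo] -->
    fine 'E_(M n)[Phi \o f] - Phi (fine 'E_(M n)[f]).
  by apply: cvgB => //; apply: continuous_cvg limf.
rewrite -/(M n) -/(M n.-1) /Ent fine_expectationK// -EFinB.
have Fc j k : (L j <= k)%N -> F j k = f (L j) by move=> Lk; rewrite /F (minn_idPr _).
(* For k < L j also k + 1 <= L j, so truncation keeps the increment at k. *)
have FE j k : (k < L j)%N -> (F j k, Delta (F j) k) = (f k, Delta f k).
  by move=> kL; rewrite /Delta /F !(minn_idPl _)// ltnW.
have F0 j k : (L j <= k)%N -> (F j k, Delta (F j) k) = (f (L j), 0).
  by move=> kL; rewrite /Delta !Fc ?subrr// leqW.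
have A0 k : 0 <= A_ Phi (f k, Delta f k).
  by apply: (@A_ge0 _ I) => //; rewrite /Delta addrC subrK.
have E0 k : 0 <= energy Phi p f k by exact: (@energy_ge0 _ I).
(* From L j on the truncated increments are 0, so nonnegative energies are replaced by 0 there. *)
have FA j k : A_ Phi (F j k, Delta (F j) k) <= A_ Phi (f k, Delta f k).
  by have [kL|Lk] := ltnP k (L j); [rewrite FE|rewrite F0// A_0].
have FEn j k : energy Phi p (F j) k <= energy Phi p f k.
  have [kL|Lk] := ltnP k (L j); first by rewrite /energy FE.
  by rewrite [leLHS]/energy F0// tau_0 A_0 !mulr0 addr0.
have IF j k : I (F j k) by exact: If.
have limE : ((fine 'E_(M n)[Phi \o F j] - Phi (fine 'E_(M n)[F j]))%:E @[j --> \oo] -->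
    (fine 'E_(M n)[Phi \o f] - Phi (fine 'E_(M n)[f]))%:E)%E.
  by apply: cvg_EFin; [exact: nearW|exact: lim].
(* The right side does not depend on j, so a bound on every truncated entropy passes to the
   limit. *)
apply: (cvge_to_le limE); apply: nearW => j.
have := @entropy_eventually_cst_le R I Phi I_open I_itv Phi_smooth Phi_convex
  A_convex p rho p01 rho_ge0 n (L j) (f (L j)) (F j) (IF j) (Fc j).
rewrite -lee_fin => /le_trans; apply.
rewrite EFinD (EFinM rho) (EFinM (n%:R * p * q)); apply: leeD.
  apply: lee_wpmul2l; first by rewrite lee_fin.
  apply: ge0_fine_expectation_le => //.
    apply: (integral_eventually_cst (c := 0) (m := L j) _ _).1 => k Lk.
    by rewrite F0// A_0.
  by move=> k; apply: (@A_ge0 _ I) => //; rewrite /Delta addrC subrK.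
apply: lee_wpmul2l; first by rewrite lee_fin.
apply: (ge0_fine_expectation_le (H := energy Phi p f)) => //.
  apply: (integral_eventually_cst (c := 0) (m := L j) _ _).1 => k Lk.
  by rewrite /energy F0// tau_0 A_0 !mulr0 addr0.
by move=> k; exact: (@energy_ge0 _ I).
Qed.
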